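(* For every integer $k\ge 2$ and every integer $n\ge k(2k-1)$, \[ \mu_k(\mathbb Z_n)=2k. \]
   Context: $\mathbb Z_n$ denotes the (additive) cyclic group of order $n$. For a subset $S\subseteq \mathbb Z_n$, write $\sigma(S)=\sum_{s\in S}s\in\mathbb Z_n$. For $k\ge 2$, $\mu_k(\mathbb Z_n)$ is the least cardinality of a subset $S\subseteq\mathbb Z_n$ such that $k\mid |S|$, $\sigma(S)=0$, and $S$ admits no partition into zero-sum $k$-subsets, i.e. $S$ cannot be written as a disjoint union $T_1\sqcup\cdots\sqcup T_m$ ($m\ge0$) with $|T_i|=k$ and $\sigma(T_i)=0$ for all $i$ (the empty set has the empty partition, $m=0$). If no such subset $S$ exists, $\mu_k(\mathbb Z_n)=\infty$. *)

(* Defs.v *)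
From mathcomp Require Import all_boot all_order all_algebra.
Set Implicit Arguments.
Unset Strict Implicit.
Unset Printing Implicit Defensive.
Import GRing.Theory.
Local Open Scope ring_scope.

Definition sigma (G : finZmodType) (S : {set G}) : G := \sum_(s in S) s.

(* [partition P S] also demands that no block is empty; this is automatic for
   blocks of cardinality k >= 1.  For S = set0 the witness is P = set0. *)
Definition has_zero_sum_partition (G : finZmodType) (k : nat) (S : {set G}) : bool :=
  [exists P : {set {set G}},
    partition P S && [forall T in P, (#|T| == k) && (sigma T == 0)]].

Definition mu_admissible (G : finZmodType) (k : nat) (S : {set G}) : bool :=
  [&& (k %| #|S|)%N, sigma S == 0 & ~~ has_zero_sum_partition k S].

(* The value [None] stands for infinity. *)
Definition mu (k : nat) (G : finZmodType) : option nat :=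
  if [pick S : {set G} | mu_admissible k S] is Some S0
  then Some #|[arg min_(S < S0 | mu_admissible k S) #|S|]|
  else None.

Lemma mu_SomeP (k : nat) (G : finZmodType) (m : nat) :
  mu k G = Some m <->
  (exists2 S : {set G}, mu_admissible k S & #|S| = m) /\
  (forall S : {set G}, mu_admissible k S -> (m <= #|S|)%N).
Proof.
rewrite /mu; case: pickP => [S0 adm0|none]; last first.
  by split=> // -[[S]]; rewrite none.
case: arg_minnP => // S admS minS; split=> [[<-]|[[S' admS' <-] minS']].
  by split=> //; exists S.
by congr Some; apply/eqP; rewrite eqn_leq minS // minS'.
Qed.

Lemma mu_NoneP (k : nat) (G : finZmodType) :
  mu k G = None <-> forall S : {set G}, ~~ mu_admissible k S.
Proof.
rewrite /mu; case: pickP => [S0 adm0|none]; last by split=> // _ S; rewrite none.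
by split=> // /(_ S0); rewrite adm0.
Qed.

(* Main.v *)
Require Import Defs.
From mathcomp Require Import all_boot all_order all_algebra zify.

(** A set of size 0 or k is no obstruction, so mu is at least 2k. For equality
    take S = {0, ..., 2k-2} together with x = - (0 + ... + (2k-2)). As integers,
    0 + ... + (2k-2) = (2k-1)(k-1), so adding any element of {0, ..., 2k-2}
    gives a value in (0, n): hence x is a new element. A k-subset of
    {0, ..., 2k-2} has an integer sum in (0, n), so it is not zero-sum; but a
    partition of S into k-subsets has a block that avoids x. *)

Import GRing.Theory.
Local Open Scope ring_scope.

(** Lifts the sum to the naturals, where its size can be compared with [n]. *)
Lemma sigma_Zp n (T : {set 'Z_n}) : sigma T = (\sum_(t in T) t)%N%:R.
Proof. by rewrite natr_sum; apply: eq_bigr => t _; rewrite natr_Zp. Qed.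

Lemma natr_Zp_neq0 n s : (1 < n)%N -> (0 < s < n)%N -> s%:R != 0 :> 'Z_n.
Proof.
move=> n_gt1 /andP[s_gt0 s_ltn]; apply/eqP => /(congr1 val).
by rewrite /= val_Zp_nat // modn_small // => s0; rewrite s0 in s_gt0.
Qed.

(** A vanishing sum of naturals has only zero terms, and two distinct ordinals cannot both be 0. *)
Lemma sum_ord_gt0 n (T : {set 'I_n}) : (1 < #|T|)%N -> (0 < \sum_(t in T) t)%N.
Proof.
move=> /card_gt1P[a [b [aT bT neq_ab]]]; rewrite lt0n sum_nat_eq0.
apply: contra neq_ab => /forall_inP T0.
by apply/eqP/val_inj; rewrite /= (eqP (T0 a aT)) (eqP (T0 b bT)).
Qed.

(** The block of [x] is too small to be all of [S], so it misses some [y]; the block of [y] is then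
    disjoint from it. *)
Lemma partition_avoids (T : finType) (P : {set {set T}}) (S : {set T}) x :
    partition P S -> x \in S -> (forall B, B \in P -> #|B| < #|S|)%N ->
  exists2 B, B \in P & x \notin B.
Proof.
case/and3P=> /eqP covP trivP _ xS ltPS.
have Px : pblock P x \in P by rewrite pblock_mem ?covP.
have /subsetPn[y yS yNx] : ~~ (S \subset pblock P x).
  by apply: contraL (ltPS _ Px) => /subset_leq_card; rewrite -leqNgt.
have Py : pblock P y \in P by rewrite pblock_mem ?covP.
exists (pblock P y) => //; apply: contra yNx => xy.
by rewrite (def_pblock trivP Py xy) mem_pblock covP.
Qed.

Lemma mu_admissible_ge (G : finZmodType) k (S : {set G}) :
  mu_admissible k S -> (2 * k <= #|S|)%N.
Proof.
case/and3P=> /dvdnP[[|[|q]] cardS] sS0 noP; last by rewrite cardS leq_mul2r orbT.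
  case/existsP: noP; exists set0.
  move: cardS => /eqP; rewrite mul0n cards_eq0 => /eqP->.
  rewrite /partition /cover big_set0 eqxx inE andbT /=.
  apply/andP; split; last by apply/forall_inP => T; rewrite inE.
  by apply/trivIsetP => A B; rewrite inE.
(* Now [#|S| = k], and [[set S]] is a partition unless [S] is empty; that forces [k = 0], where the
   bound is trivial. *)
have [S0|S0] := eqVneq S set0.
  by move: cardS; rewrite S0 cards0; lia.
case/existsP: noP; exists [set S].
rewrite /partition /cover big_set1 eqxx inE eq_sym S0 andbT /=.
apply/andP; split; last first.
  by apply/forall_inP => T; rewrite inE => /eqP->; rewrite cardS mul1n eqxx.
apply/trivIsetP => A B; rewrite !inE => /eqP-> /eqP->.
by rewrite eqxx.
Qed.

Section Obstruction.

Variables (k n : nat).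
Hypotheses (hk : (2 <= k)%N) (hn : (k * (2 * k - 1) <= n)%N).

Let n_gt1 : (1 < n)%N. Proof. nia. Qed.

Definition initial_segment : {set 'Z_n} := [set i : 'Z_n | (i < 2 * k - 1)%N].

Definition obstruction : {set 'Z_n} :=
  - sigma initial_segment |: initial_segment.

(** The carrier of ['Z_n] is ['I_(Zp_trunc n).+2]; [big_ord_widen] needs the segment to fit inside
    it. *)
Let le_Zp : (2 * k - 1 <= (Zp_trunc n).+2)%N.
Proof. by rewrite Zp_cast //; nia. Qed.

Lemma card_initial_segment : #|initial_segment| = (2 * k - 1)%N.
Proof.
rewrite -sum1_card (eq_bigl (fun i : 'Z_n => (i < 2 * k - 1)%N)); last first.
  by move=> i; rewrite inE.
by rewrite -(big_ord_widen _ (fun=> 1%N) le_Zp) sum1_card card_ord.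
Qed.

Lemma sum_initial_segment :
  (\sum_(i in initial_segment) i = (2 * k - 1) * (k - 1))%N.
Proof.
rewrite (eq_bigl (fun i : 'Z_n => (i < 2 * k - 1)%N)); last first.
  by move=> i; rewrite inE.
rewrite -(big_ord_widen _ id le_Zp) -(big_mkord xpredT id) bin2_sum bin2.
have -> : ((2 * k - 1).-1 = (k - 1).*2)%N by lia.
by rewrite -doubleMr doubleK.
Qed.

Lemma initial_segment_not_zero_sum (T : {set 'Z_n}) :
  T \subset initial_segment -> (1 < #|T|)%N -> sigma T != 0.
Proof.
move=> TA T_gt1; rewrite sigma_Zp natr_Zp_neq0 // sum_ord_gt0 //=.
apply: (@leq_ltn_trans (\sum_(t in initial_segment) t)).
  by rewrite [leqRHS](big_setID T) /= (setIidPr TA) leq_addr.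
by rewrite sum_initial_segment; nia.
Qed.

Lemma opp_sigma_notin_initial_segment :
  - sigma initial_segment \notin initial_segment.
Proof.
apply/negP; rewrite inE; set x := - _ => x_lt.
have : sigma initial_segment + x == 0 by rewrite subrr.
rewrite sigma_Zp sum_initial_segment -[x]natr_Zp -natrD.
(* As [x <= 2k - 2], the natural sum is at most [(2k - 1)(k - 1) + 2k - 2 = k(2k - 1) - 1], just
   below the bound on [n]. *)
by apply/negP/natr_Zp_neq0 => //; nia.
Qed.

Lemma card_obstruction : #|obstruction| = (2 * k)%N.
Proof.
rewrite cardsU1 opp_sigma_notin_initial_segment card_initial_segment; lia.
Qed.

Lemma obstruction_admissible : mu_admissible k obstruction.
Proof.
rewrite /mu_admissible card_obstruction dvdn_mull //=; apply/andP; split.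
  by rewrite /sigma big_setU1 ?opp_sigma_notin_initial_segment //= addNr.
apply/existsP => -[P /andP[partP /forall_inP zsP]].
have xS : - sigma initial_segment \in obstruction by rewrite setU11.
(* Blocks have [k < 2k] elements, so one of them avoids the added element and lies in the initial
   segment. *)
have [|T PT xNT] := partition_avoids _ _ _ _ partP xS.
  by move=> B /zsP/andP[/eqP-> _]; rewrite card_obstruction; lia.
have /andP[/eqP cardT] := zsP T PT; apply/negP.
apply: initial_segment_not_zero_sum; last by rewrite cardT.
have /subsetP TS : T \subset obstruction.
  by rewrite -(cover_partition partP) bigcup_sup.
apply/subsetP => t tT; case/setU1P: (TS t tT) => // tx.
by rewrite -tx tT in xNT.
Qed.

End Obstruction.

Local Close Scope ring_scope.

Theorem proposition3p1 (k n : nat) (hk : 2 <= k) (hn : k * (2 * k - 1) <= n) :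
  mu k 'Z_n = Some (2 * k).
Proof.
apply/mu_SomeP; split; last by move=> S /mu_admissible_ge.
by exists (obstruction k n); [apply: obstruction_admissible|apply: card_obstruction].
Qed.
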